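(* For any integer $k \geq 5$, $\mathrm{sat}(n,K_3,C_k) = 0$ for all $n \geq 2k+2$.
   Context: All graphs are finite and simple. A graph $G$ is $F$-free if it contains no (not necessarily induced) subgraph isomorphic to $F$. $G$ is $F$-saturated if $G$ is $F$-free but adding any nonedge to $G$ creates at least one copy of $F$. A copy of $H$ in $G$ is a (not necessarily induced) subgraph of $G$ isomorphic to $H$. $\mathrm{sat}(n,H,F)$ denotes the minimum number of copies of $H$ in an $n$-vertex $F$-saturated graph. $K_m$ is the complete graph on $m$ vertices and $C_m$ is the cycle on $m$ vertices. *)

(* Defs.v *)
From HB Require Import structures.
From mathcomp Require Import all_boot.

Set Implicit Arguments.
Unset Strict Implicit.
Unset Printing Implicit Defensive.

Record sgraph (V : finType) := SGraph {
  edges : {set {set V}};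
  edges_card2 : [forall e in edges, #|e| == 2]
}.

HB.instance Definition _ (V : finType) := [isSub for @edges V].
HB.instance Definition _ (V : finType) := [Finite of sgraph V by <:].

Fact filter_card2 (V : finType) (E : {set {set V}}) :
  [forall e in [set e in E | #|e| == 2], #|e| == 2].
Proof. by apply/forall_inP => e; rewrite inE => /andP[]. Qed.

(* The members of E that are not 2-element sets are discarded. *)
Definition graph_of (V : finType) (E : {set {set V}}) : sgraph V :=
  SGraph (filter_card2 E).

Definition adj (V : finType) (G : sgraph V) (x y : V) : bool :=
  [set x; y] \in edges G.

Definition complete_graph (m : nat) : sgraph 'I_m := graph_of [set: {set 'I_m}].

(* ordS i is i.+1 modulo m; this is the cycle C_m only for 3 <= m. *)
Definition cycle_graph (m : nat) : sgraph 'I_m :=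
  graph_of [set [set i; ordS i] | i : 'I_m].

Definition add_edge (V : finType) (G : sgraph V) (x y : V) : sgraph V :=
  graph_of ([set x; y] |: edges G).

Section Copies.
Variables (VH V : finType) (H : sgraph VH) (G : sgraph V).

(* A pair S = (W, E) stands for the graph with vertex set W and edge set E. *)
Definition subgraph_of (S : {set V} * {set {set V}}) : bool :=
  (S.2 \subset edges G) && [forall e in S.2, e \subset S.1].

Definition isomorphic_to (S : {set V} * {set {set V}}) : bool :=
  [exists f : {ffun VH -> V},
    [&& injectiveb f, f @: [set: VH] == S.1 &
        [forall x, forall y, adj H x y == ([set f x; f y] \in S.2)]]].

Definition copies : {set {set V} * {set {set V}}} :=
  [set S | subgraph_of S & isomorphic_to S].

End Copies.

Definition free (VF V : finType) (F : sgraph VF) (G : sgraph V) : bool :=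
  copies F G == set0.

Definition saturated (VF V : finType) (F : sgraph VF) (G : sgraph V) : bool :=
  free F G &&
  [forall x, forall y, (x != y) && ~~ adj G x y ==> ~~ free F (add_edge G x y)].

(* None when there is no F-saturated graph on n vertices. *)
Definition sat (n : nat) (VH VF : finType) (H : sgraph VH) (F : sgraph VF) :
    option nat :=
  if [pick G : sgraph 'I_n | saturated F G] is Some G0 then
    Some #|copies H [arg min_(G < G0 | saturated F G) #|copies H G|]|
  else None.

Lemma satP (n : nat) (VH VF : finType) (H : sgraph VH) (F : sgraph VF) (m : nat) :
  sat n H F = Some m <->
  (exists2 G : sgraph 'I_n, saturated F G & #|copies H G| = m) /\
  (forall G : sgraph 'I_n, saturated F G -> m <= #|copies H G|).
Proof.
rewrite /sat; case: pickP => [G0 satG0 | nosat]; last first.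
  by split=> // -[[G]]; rewrite nosat.
case: arg_minnP => // G satG minG; split=> [[<-] | [[G1 satG1 <-] le_m]].
  by split=> //; exists G.
by congr Some; apply/eqP; rewrite eqn_leq minG // le_m.
Qed.

(* Main.v *)
Require Import Defs.
From mathcomp Require Import all_boot zify.

(** It is enough to exhibit, for each k >= 5 and n >= 2 * k + 2, one
    triangle-free C_k-saturated graph on n vertices.  Saturation amounts to
    this: there is no k-cycle, and any two distinct nonadjacent vertices are
    joined by a path with k - 1 edges.

    For odd k = 2t + 1, take a complete bipartite graph with at least t + 1
    vertices on each side: it has no odd cycle, and two vertices of one side are
    joined by paths of every even length from 2 to 2t.

    For even k = 2t + 2 with t >= 2, both parities of path length are needed,
    but even cycles have to stay short.  Take three complete bipartite blocks
    arranged as a necklace.  For each s in {false, true} there is a block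
    K(A s, B s) with #|A s| = t and #|B s| >= t.  The sets A false and A true
    share exactly one vertex, the hub, and each A s has one further special
    vertex, the port p_s.  The third block is a 4-cycle K({p_0, q_0}, {p_1, q_1})
    on the two ports and two new vertices q_0, q_1, the twins.  Two consecutive
    blocks meet in one vertex (the hub or a port).

    Why there is no k-cycle.  Removing the hub leaves a bipartite graph whose
    colouring gives different colours to the neighbours of the hub in the two
    blocks; hence a cycle that runs around the necklace is odd, whereas k is
    even.  Every other cycle stays inside one block, by the cut vertices, and so
    has length 4 or at most 2t (lemma necklace_no_cycle).

    Why nonadjacent vertices are joined by paths of length 2t + 1.  The two ways
    around the necklace between two vertices have different parities, and inside
    a block K(A s, B s) the length of a path can be adjusted freely by steps of
    2: up to 2t - 2 between two vertices of A s, and up to 2t - 1 between A s and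
    B s.  The detour through both twins, which replaces the edge between the
    ports by a path of length 3, gives the pairs that would otherwise fall short
    by 2 (lemma necklace_linked).

    The necklace has 3t + 1 + #|B true| vertices when #|B false| = t, and
    #|B true| can be any number that is at least t, so all orders n >= 4t + 1
    are reached. *)

Set Implicit Arguments.
Unset Strict Implicit.
Unset Printing Implicit Defensive.

(** * Copies and saturation in terms of maps and cycles *)

Lemma set2_inj (V : finType) (x y u w : V) :
  [set x; y] = [set u; w] -> (x = u /\ y = w) \/ (x = w /\ y = u).
Proof.
move=> E.
have : x \in [set u; w] by rewrite -E !inE eqxx.
have : y \in [set u; w] by rewrite -E !inE eqxx orbT.
have : u \in [set x; y] by rewrite E !inE eqxx.
have : w \in [set x; y] by rewrite E !inE eqxx orbT.
rewrite !inE => /orP[]/eqP-> /orP[]/eqP-> /orP[]/eqP e1 /orP[]/eqP e2; subst; auto.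
Qed.

Lemma cycle_nthP (T : Type) (e : rel T) (x0 : T) (p : seq T) :
  reflect (forall i, i < size p -> e (nth x0 p i) (nth x0 p (i.+1 %% size p)))
          (cycle e p).
Proof.
case: p => [|x q] /=; first by apply: ReflectT.
apply: (iffP (pathP x0)) => He i.
  rewrite ltnS => leiq; have := He i; rewrite size_rcons ltnS => /(_ leiq).
  rewrite -rcons_cons nth_rcons /= ltnS leiq nth_rcons.
  case: (ltngtP i (size q)) leiq => // [ltiq _|-> _].
    by rewrite modn_small.
  by rewrite modnn.
rewrite size_rcons ltnS => leiq; have := He i; rewrite ltnS => /(_ leiq).
rewrite -rcons_cons nth_rcons /= ltnS leiq nth_rcons.
case: (ltngtP i (size q)) leiq => // [ltiq _|-> _].
  by rewrite modn_small.
by rewrite modnn.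
Qed.

Section Homs.
Variables (VH V : finType) (H : sgraph VH) (G : sgraph V).

Lemma adj_sym : symmetric (adj G).
Proof. by move=> x y; rewrite /adj setUC. Qed.

Lemma adj_neq x y : adj G x y -> x != y.
Proof.
by move=> /(forall_inP (edges_card2 G)); rewrite cards2; case: (x != y).
Qed.

(** A copy is the image of an injective homomorphism, and conversely the image of
    such a map, taken with the images of the edges only, is a copy. *)
Lemma copies_homP :
  reflect (exists2 f : VH -> V, injective f & {homo f : x y / adj H x y >-> adj G x y})
          (copies H G != set0).
Proof.
apply: (iffP (set0Pn _)) => [[[W E]]|[f inj_f hom_f]].
  rewrite inE => /andP[/andP[/= sEG _] /existsP[f /and3P[/injectiveP inj_f _ /= fE]]].
  exists f => // x y; rewrite (eqP (forallP (forallP fE x) y)).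
  exact: (subsetP sEG).
have set2f x y : f @: [set x; y] = [set f x; f y] by rewrite imsetU1 imset_set1.
exists (f @: [set: VH], [set f @: d | d : {set VH} in edges H]); rewrite inE.
apply/andP; split.
  apply/andP; split=> /=.
    apply/subsetP => _ /imsetP[d Hd ->].
    have /cards2P[x [y [_ dE]]] := forall_inP (edges_card2 H) d Hd.
    by rewrite dE set2f; apply: hom_f; rewrite /adj -dE.
  by apply/forall_inP => _ /imsetP[d _ ->]; apply: imsetS; apply: subsetT.
apply/existsP; exists (finfun f); apply/and3P; split=> /=.
- by apply/injectiveP => x y; rewrite !ffunE => /inj_f.
- by apply/eqP/eq_imset => x; rewrite ffunE.
apply/forallP => x; apply/forallP => y; rewrite !ffunE -set2f /adj.
by rewrite mem_imset //; apply: imset_inj.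
Qed.

End Homs.

Lemma ordS_neq m (i : 'I_m) : 1 < m -> i != ordS i.
Proof.
move=> m1; apply/eqP => /(congr1 val) /=.
have := ltn_ord i; rewrite leq_eqVlt => /orP[/eqP e|lt].
  by rewrite e modnn; lia.
by rewrite modn_small //; lia.
Qed.

Lemma adj_cycle_graph m (i j : 'I_m) :
  1 < m -> adj (cycle_graph m) i j = (j == ordS i) || (i == ordS j).
Proof.
move=> m1; rewrite /adj inE; apply/andP/idP => [[/imsetP[u _ /set2_inj]]|].
  by case=> [[-> ->]|[-> ->]]; rewrite eqxx ?orbT.
case/orP => /eqP->; rewrite cards2 ?[ordS j == _]eq_sym ordS_neq //; split=> //.
  exact: imset_f.
by rewrite setUC; apply: imset_f.
Qed.

Lemma cycle_copyP (V : finType) (G : sgraph V) (m : nat) : 2 < m ->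
  reflect (exists p : seq V, [/\ size p = m, uniq p & cycle (adj G) p])
          (~~ free (cycle_graph m) G).
Proof.
move=> m2; have m1 : 1 < m by lia.
apply: (iffP (copies_homP _ _)) => [[f inj_f hom_f]|[p [size_p uniq_p cyc_p]]].
  have x0 : 'I_m := Ordinal (ltnW m1).
  exists (codom f); split; first by rewrite size_codom card_ord.
    by rewrite map_inj_uniq ?enum_uniq.
  apply/(cycle_nthP _ (f x0)) => i; rewrite size_codom card_ord => lt_im.
  rewrite !(nth_map x0) -?enumT ?size_enum_ord ?ltn_mod ?(ltnW m1) //.
  apply: hom_f; rewrite adj_cycle_graph //; apply/orP; left.
  by apply/eqP/val_inj; rewrite /= !nth_enum_ord // ltn_mod ltnW.
case: p => [|x0 q] in size_p uniq_p cyc_p *; first by rewrite -size_p in m2.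
have e_nth (i : 'I_m) : adj G (nth x0 (x0 :: q) i) (nth x0 (x0 :: q) (ordS i)).
  by have /(cycle_nthP _ x0) := cyc_p; rewrite size_p; apply; apply: ltn_ord.
exists (fun i : 'I_m => nth x0 (x0 :: q) i) => [i j /eqP|i j].
  by rewrite nth_uniq ?size_p // => /eqP/val_inj.
rewrite adj_cycle_graph // => /orP[]/eqP->; first exact: e_nth.
by rewrite adj_sym.
Qed.

(** * Paths of prescribed length *)

Section Linked.
Variables (V : finType) (e : rel V).

(** The set S that contains the path is recorded so that a path can be prolonged
    by a vertex known to lie outside S, without looking at the path itself. *)
Definition linked (S : {set V}) (l : nat) (x y : V) : Prop :=
  exists p, [/\ path e x p, last x p = y, uniq (x :: p), {subset x :: p <= S}
             & size p = l].

Lemma linked_edge x y : e x y -> x != y -> linked [set x; y] 1 x y.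
Proof.
move=> exy nxy; exists [:: y]; split=> //=; rewrite ?exy ?inE ?nxy //.
by move=> w; rewrite !inE.
Qed.

Lemma linked_cons (S : {set V}) l x y z :
  e x y -> x \notin S -> linked S l y z -> linked (x |: S) l.+1 x z.
Proof.
move=> exy xS [p [pp lp up sp <-]]; exists (y :: p); split=> //=.
- by rewrite exy.
- by move: up => /= ->; rewrite andbT; apply: contra xS => /sp.
- move=> w; rewrite in_cons in_setU1 => /orP[->//|/sp ->]; exact: orbT.
Qed.

Lemma linked_sub (S T : {set V}) l x y :
  S \subset T -> linked S l x y -> linked T l x y.
Proof.
move=> /subsetP sST [p [pp lp up sp sz]].
by exists p; split=> // w /sp/sST.
Qed.

Hypothesis e_sym : symmetric e.

Lemma linked_sym (S : {set V}) l x y : linked S l x y -> linked S l y x.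
Proof.
move=> [p [pp lp up sp sz]]; exists (rev (belast x p)).
have E : y :: rev (belast x p) = rev (x :: p) by rewrite [x :: p]lastI rev_rcons lp.
split.
- by rewrite -lp rev_path (eq_path (e' := e)) // => u w; rewrite e_sym.
- by rewrite -(last_cons y) E rev_cons last_rcons.
- by rewrite E rev_uniq.
- by move=> w; rewrite E mem_rev => /sp.
- by rewrite size_rev size_belast.
Qed.

Lemma linked_rcons (S : {set V}) l x y z :
  linked S l x y -> e y z -> z \notin S -> linked (z |: S) l.+1 x z.
Proof.
move=> /linked_sym Lyx eyz zS; apply: linked_sym.
by apply: linked_cons Lyx => //; rewrite e_sym.
Qed.

(** Induction on the length: the path starts with x, b for some b other than y,
    and continues with a path from a vertex a other than x to y that avoids x
    and b. *)
Lemma linked_bip (l : nat) (A B : {set V}) x y :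
  [disjoint A & B] -> (forall a b, a \in A -> b \in B -> e a b) ->
  l < #|A| -> l < #|B| -> x \in A -> y \in B -> linked (A :|: B) l.*2.+1 x y.
Proof.
elim: l => [|l IHl] in A B x y *; move=> dAB eAB lA lB xA yB.
  apply: linked_sub (linked_edge _ _); last 2 first.
  - exact: eAB.
  - by apply: contraTneq xA => ->; rewrite (disjointFl dAB).
  - by rewrite subUset !sub1set !inE xA yB orbT.
have [a aA] : exists a, a \in A :\ x.
  by apply/card_gt0P; move: lA; rewrite (cardsD1 x) xA; lia.
have [b bB] : exists b, b \in B :\ y.
  by apply/card_gt0P; move: lB; rewrite (cardsD1 y) yB; lia.
have [nax aA'] := setD1P aA; have [nby bB'] := setD1P bB.
have L : linked ((A :\ x) :|: (B :\ b)) l.*2.+1 a y.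
  apply: IHl => //.
  - by apply: disjointWl (disjointWr (subD1set _ _) dAB); apply: subD1set.
  - by move=> u w /setD1P[_ uA] /setD1P[_ wB]; apply: eAB.
  - by move: lA; rewrite (cardsD1 x) xA; lia.
  - by move: lB; rewrite (cardsD1 b) bB'; lia.
  - by rewrite !inE eq_sym nby.
have xNB : x \notin B by rewrite (disjointFr dAB).
have bNA : b \notin A by rewrite (disjointFl dAB).
have {L} L : linked (b |: ((A :\ x) :|: (B :\ b))) l.*2.+2 b y.
  apply: linked_cons L; first by rewrite e_sym eAB.
  by rewrite !inE eqxx (negPf bNA) andbF.
apply: linked_sub (linked_cons (eAB x b xA bB') _ L).
  apply/subsetP=> w; rewrite !inE => /or4P[/eqP->|/eqP->|/andP[_ ->]|/andP[_ ->]];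
    by rewrite ?xA ?bB' ?orbT.
rewrite !inE eqxx (negPf xNB) /= andbF !orbF.
by apply: contraNneq xNB => ->.
Qed.

(** A path of odd length from x to some b in B that avoids y, then the edge from
    b to y. *)
Lemma linked_bip_even (l : nat) (A B : {set V}) x y :
  [disjoint A & B] -> (forall a b, a \in A -> b \in B -> e a b) ->
  0 < l -> l < #|A| -> l <= #|B| -> x \in A -> y \in A -> x != y ->
  linked (A :|: B) l.*2 x y.
Proof.
case: l => // l dAB eAB _ lA lB xA yA nxy.
have [b bB] : exists b, b \in B by apply/card_gt0P; lia.
have L : linked ((A :\ y) :|: B) l.*2.+1 x b.
  apply: linked_bip => //.
  - by apply: disjointWl dAB; apply: subD1set.
  - by move=> u w /setD1P[_ uA]; apply: eAB.
  - by move: lA; rewrite (cardsD1 y) yA; lia.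
  - by rewrite !inE nxy.
apply: linked_sub (linked_rcons (z := y) L _ _).
- by rewrite setUA setD1K.
- by rewrite e_sym eAB.
by rewrite !inE eqxx /= (disjointFr dAB).
Qed.

End Linked.

(** * From a relation to the saturation number *)

Section RelGraph.
Variables (V : finType) (e : rel V).
Hypotheses (e_sym : symmetric e) (e_irr : irreflexive e).

Definition rel_graph : sgraph V :=
  graph_of [set [set u.1; u.2] | u : V * V & e u.1 u.2].

Lemma adj_rel_graph : adj rel_graph =2 e.
Proof.
move=> x y; rewrite /adj inE; apply/andP/idP => [[/imsetP[[u w]]]|exy].
  by rewrite inE /= => euw /set2_inj[[-> ->]|[-> ->]]; rewrite // e_sym.
split; first by apply/imsetP; exists (x, y); rewrite ?inE.
rewrite cards2 (_ : x != y) //.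
by apply: contraTneq exy => ->; rewrite e_irr.
Qed.

Lemma adj_add_edge (G : sgraph V) x y u w :
  x != y -> adj (add_edge G x y) u w = ([set u; w] == [set x; y]) || adj G u w.
Proof.
move=> nxy; rewrite /adj !inE; case: (eqVneq [set u; w] _) => [->|_] /=.
  by rewrite cards2 nxy.
by apply: andb_idr => /adj_neq nuw; rewrite cards2 nuw.
Qed.

Lemma copies_triangle_eq0 :
  (forall x y z, e x y -> e y z -> ~~ e x z) ->
  copies (complete_graph 3) rel_graph = set0.
Proof.
move=> e_tri; apply/eqP/negPn/negP => /copies_homP[f _ hom_f].
have ef (i j : 'I_3) : i != j -> e (f i) (f j).
  move=> nij; rewrite -adj_rel_graph; apply: hom_f.
  by rewrite /adj !inE cards2 nij.
pose i0 : 'I_3 := ord0; pose i2 : 'I_3 := ord_max.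
pose i1 : 'I_3 := @Ordinal 3 1 isT.
by have := e_tri _ _ _ (ef i0 i1 isT) (ef i1 i2 isT); rewrite ef.
Qed.

(** A path with k - 1 edges between two nonadjacent vertices closes up to a
    k-cycle when the edge between them is added. *)
Lemma rel_graph_saturated k : 2 < k ->
  (forall p, size p = k -> uniq p -> ~~ cycle e p) ->
  (forall x y, x != y -> ~~ e x y -> linked e [set: V] k.-1 x y) ->
  saturated (cycle_graph k) rel_graph.
Proof.
move=> k2 no_cyc conn; apply/andP; split.
  apply/negPn/negP => /(cycle_copyP _ k2)[p [size_p uniq_p]].
  by rewrite (eq_cycle adj_rel_graph) => /idPn[]; apply: no_cyc.
apply/forallP => x; apply/forallP => y; apply/implyP => /andP[nxy].
rewrite adj_rel_graph => /(conn _ _ nxy)[p [path_p last_p uniq_p _ size_p]].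
apply/(cycle_copyP _ k2); exists (x :: p); split=> //=; first by rewrite size_p; lia.
rewrite rcons_path last_p adj_add_edge // setUC eqxx andbT.
by apply: sub_path path_p => u w euw; rewrite adj_add_edge // adj_rel_graph euw orbT.
Qed.

End RelGraph.

Lemma sat_triangle_cycle_eq0 n k (e : rel 'I_n) :
  2 < k -> symmetric e ->
  (forall x y z, e x y -> e y z -> ~~ e x z) ->
  (forall p, size p = k -> uniq p -> ~~ cycle e p) ->
  (forall x y, x != y -> ~~ e x y -> linked e [set: 'I_n] k.-1 x y) ->
  sat n (complete_graph 3) (cycle_graph k) = Some 0.
Proof.
move=> k2 e_sym e_tri no_cyc conn.
have e_irr : irreflexive e.
  by move=> x; apply/negP => exx; have := e_tri x x x exx exx; rewrite exx.
apply/satP; split=> [|G _]; last exact: leq0n.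
exists (rel_graph e); first exact: rel_graph_saturated.
by rewrite copies_triangle_eq0 ?cards0.
Qed.

(** * Parity and cut vertices of cycles *)

Section Cycles.
Variables (V : finType) (e : rel V).

(** The vertices coloured true correspond to their successors, which are
    coloured false. *)
Lemma cycle_bipartite (chi : pred V) p :
  cycle (fun x y => chi x != chi y) p -> size p = (count chi p).*2.
Proof.
move=> cyc_p.
have half : count chi p = count (predC chi) p.
  have count_path x q : path (fun x y => chi x != chi y) x q ->
      count chi q = count (predC chi) (belast x q).
    elim: q x => //= y q IHq x /andP[cxy /IHq ->].
    by case: (chi x) (chi y) cxy => [] [].
  case: p cyc_p => //= x q /count_path.
  by rewrite belast_rcons -cats1 count_cat /= addn0 addnC.
by rewrite -(count_predC chi p) -half addnn.
Qed.

(** The reason is that z is a cut vertex: S can only change along the cycle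
    when the cycle passes through z, which it does at most once. *)
Lemma cycle_cut (z : V) (S : pred V) p :
  (forall x y, x != z -> y != z -> e x y -> S x = S y) -> uniq p -> cycle e p ->
  all (predU1 z S) p \/ all (predU1 z (predC S)) p.
Proof.
move=> Sinv uniq_p cyc_p.
have same q y : z \notin y :: q -> path e y q -> all (fun x => S x == S y) (y :: q).
  elim: q y => [|w q IHq] y /=; first by rewrite eqxx.
  rewrite inE negb_or eq_sym => /andP[nyz zq] /andP[eyw /(IHq _ zq)].
  have nwz : w != z by apply: contraNneq zq => ->; rewrite mem_head.
  by rewrite (Sinv y w) //= eqxx.
have good q y : z \notin y :: q -> path e y q ->
    all (predU1 z S) (y :: q) \/ all (predU1 z (predC S)) (y :: q).
  move=> zq /(same _ _ zq) all_q; case Sy: (S y); [left|right];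
  by apply: sub_all all_q => x /eqP Sx; rewrite !inE /= Sx Sy orbT.
have [zp|zp] := boolP (z \in p); last first.
  case: p => [|y q] in zp uniq_p cyc_p *; first by left.
  by apply: good => //; move: cyc_p; rewrite /= rcons_path => /andP[].
have [i q def_p] := rot_to zp.
have all_rot a : all a p = all a (z :: q) by rewrite -def_p; apply: eq_all_r => x; rewrite mem_rot.
rewrite !all_rot /= !eqxx /=.
have: uniq (z :: q) by rewrite -def_p rot_uniq.
have: cycle e (z :: q) by rewrite -def_p rot_cycle.
case: q {def_p all_rot} => [|y q] /=; first by left.
rewrite rcons_path => /andP[_ /andP[path_q _]] /andP[zq _].
exact: good.
Qed.

End Cycles.

(** * The necklace graph *)

(** The role of a vertex in the necklace; adjacency depends on the roles only.
    The boolean tells the two sides apart: Inner s and Outer s are the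
    generic vertices of A s and of B s, while Hub, Port s and Twin s are roles of
    single vertices. *)
Inductive kind := Hub | Port of bool | Twin of bool | Inner of bool | Outer of bool.

Definition in_A (s : bool) (k : kind) : bool :=
  match k with Hub => true | Port s' | Inner s' => s' == s | _ => false end.

Definition in_B (s : bool) (k : kind) : bool :=
  if k is Outer s' then s' == s else false.

(** The third block of the necklace is complete between its gates false and
    true. *)
Definition in_gate (s : bool) (k : kind) : bool :=
  match k with Port s' | Twin s' => s' == s | _ => false end.

Definition necklace_adj (k l : kind) : bool :=
  [|| in_gate true k && in_gate false l, in_gate false k && in_gate true l |
  [exists s, (in_A s k && in_B s l) || (in_B s k && in_A s l)]].

Definition single (k : kind) : bool :=
  match k with Inner _ | Outer _ => false | _ => true end.

Definition is_hub (k : kind) : bool := if k is Hub then true else false.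

(** A proper colouring of the necklace without its hub.  The neighbours of the
    hub in the two blocks get different colours, so going around the necklace
    takes an odd number of edges. *)
Definition side (k : kind) : bool :=
  match k with Hub => true | Port s | Twin s | Inner s => s | Outer s => ~~ s end.

Lemma exists_bool (P : pred bool) : [exists s, P s] = P true || P false.
Proof.
apply/existsP/orP => [[[] Ps]|[]Ps]; [by left|by right|by exists true|by exists false].
Qed.

Lemma necklace_adj_sym : symmetric necklace_adj.
Proof.
by move=> k l; rewrite /necklace_adj !exists_bool; case: k => [|[]|[]|[]|[]]; case: l => [|[]|[]|[]|[]].
Qed.

Lemma necklace_adj_triangle k l m : necklace_adj k l -> necklace_adj l m -> ~~ necklace_adj k m.
Proof.
rewrite /necklace_adj !exists_bool.
by case: k => [|[]|[]|[]|[]]; case: l => [|[]|[]|[]|[]] //; case: m => [|[]|[]|[]|[]].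
Qed.

Lemma necklace_adj_block s k l :
  in_A s k || in_B s k -> in_A s l || in_B s l -> necklace_adj k l ->
  in_A s k != in_A s l.
Proof.
rewrite /necklace_adj !exists_bool.
by case: s; case: k => [|[]|[]|[]|[]] //; case: l => [|[]|[]|[]|[]].
Qed.

Lemma necklace_adj_side k l :
  ~~ is_hub k -> ~~ is_hub l -> necklace_adj k l -> side k != side l.
Proof.
rewrite /necklace_adj !exists_bool.
by case: k => [|[]|[]|[]|[]] //; case: l => [|[]|[]|[]|[]].
Qed.

Section Necklace.
Variables (V : finType) (kappa : V -> kind) (t : nat).
Hypotheses (t_ge2 : 2 <= t)
  (single_inj : forall x y, single (kappa x) -> kappa x = kappa y -> x = y)
  (single_ex : forall k, single k -> exists x, kappa x = k)
  (card_A : forall s, #|[set x | in_A s (kappa x)]| = t)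
  (card_B : forall s, t <= #|[set x | in_B s (kappa x)]|).

Definition necklace_rel : rel V := fun x y => necklace_adj (kappa x) (kappa y).

Definition block s : {set V} :=
  [set x | in_A s (kappa x)] :|: [set x | in_B s (kappa x)].

Local Notation e := necklace_rel.

Lemma necklace_rel_sym : symmetric e.
Proof. by move=> x y; apply: necklace_adj_sym. Qed.

(** Half of the vertices of such a cycle would be in A s, that is t + 1 of them,
    but A s has only t elements. *)
Lemma block_no_cycle s p : size p = t.*2.+2 -> uniq p ->
  {subset p <= block s} -> ~~ cycle e p.
Proof.
move=> size_p uniq_p sub_p; apply/negP => cyc_p.
pose chi x := in_A s (kappa x).
have : cycle (fun x y => chi x != chi y) p.
  apply: (sub_in_cycle (P := [in block s])) cyc_p; last exact/allP.
  by move=> x y; rewrite !inE; apply: necklace_adj_block.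
move/cycle_bipartite; rewrite size_p => size_chi.
have : count chi p <= t.
  rewrite -(card_A s) -size_filter -(card_uniqP (filter_uniq _ uniq_p)).
  by apply/subset_leq_card/subsetP => x; rewrite mem_filter inE => /andP[].
by lia.
Qed.

(** A cycle that avoids the hub is confined by the ports, which are cut vertices
    of the rest: it stays in one of the three blocks.  A cycle through the hub
    either leaves and re-enters the hub on the same side, and is confined to one
    block, or goes around the necklace and is odd. *)
Lemma necklace_no_cycle p : size p = t.*2.+2 -> uniq p -> ~~ cycle e p.
Proof.
move=> size_p uniq_p; apply/negP => cyc_p.
pose nonhub x := ~~ is_hub (kappa x).
have [hub Khub] := single_ex (k := Hub) isT.
have [z0 Kz0] := single_ex (k := Port false) isT.
have [z1 Kz1] := single_ex (k := Port true) isT.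
have [w0 Kw0] := single_ex (k := Twin false) isT.
have [w1 Kw1] := single_ex (k := Twin true) isT.
pose port s := if s then z1 else z0.
have Kport s : kappa (port s) = Port s by case: s.
have nonhubE x : nonhub x = (x != hub).
  case: eqVneq => [->|]; rewrite /nonhub ?Khub //.
  move=> nxh; apply/negP => Kx; case/eqP: nxh.
  by apply: single_inj; rewrite ?Khub; case: (kappa x) Kx.
have portP s x : kappa x = Port s -> x = port s.
  by move=> Kx; apply: single_inj; rewrite Kx ?Kport.
(* When a cycle has both neighbours of the hub in B s, removing the hub leaves
   a path between two vertices of B s.  The extra adjacencies inside B s close
   it up to a cycle, and the port of side s still is a cut vertex. *)
pose e2 s x y := [&& nonhub x, nonhub y &
  e x y || in_B s (kappa x) && in_B s (kappa y)].
have e2_block s x y : x != port s -> y != port s -> e2 s x y ->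
    (x \in block s) = (y \in block s).
  move=> xNp yNp /and3P[]; rewrite /nonhub /e /necklace_rel /necklace_adj !exists_bool !inE.
  have: kappa x <> Port s by move/portP/eqP; apply/negP.
  have: kappa y <> Port s by move/portP/eqP; apply/negP.
  by case: s {xNp yNp}; case: (kappa x) => [|[]|[]|[]|[]] //;
     case: (kappa y) => [|[]|[]|[]|[]].
have e2_cycle s q : uniq q -> cycle (e2 s) q -> {subset q <= block s} \/
    {in q, forall x, x \in block s -> x = port s}.
  move=> uniq_q /(cycle_cut (@e2_block s) uniq_q)[] /allP all_q; [left|right] => x.
    by move=> /all_q/predU1P[->|//]; rewrite !inE Kport /= eqxx.
  by move=> /all_q/predU1P[->//|/= /negPf->].
have [hub_p|hubNp] := boolP (hub \in p); last first.
  have cyc2 s : cycle (e2 s) p.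
    apply: (sub_in_cycle (P := nonhub)) cyc_p.
      by move=> x y xN yN exy; apply/and3P; split; rewrite ?exy.
    by apply/allP => x xp; rewrite nonhubE; apply: contraNneq hubNp => <-.
  have gate s : {in p, forall x, x \in block s -> x = port s}.
    have [sub_p|//] := e2_cycle s p uniq_p (cyc2 s).
    by have := block_no_cycle size_p uniq_p sub_p; rewrite cyc_p.
  (* Outside both blocks, except for the ports: only the 4-cycle is left. *)
  have : size p <= size [:: z0; z1; w0; w1].
    apply: uniq_leq_size => // x xp; have := gate true x xp; have := gate false x xp.
    have xN : x != hub by apply: contraNneq hubNp => <-.
    rewrite !inE; case Kx: (kappa x) => [|[]|[]|s|s] /=.
    - by case/eqP: xN; apply: single_inj; rewrite Kx.
    - by move=> _ ->; rewrite ?eqxx ?orbT.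
    - by move=> ->; rewrite ?eqxx ?orbT.
    - by move=> _ _; rewrite (single_inj (x := x) (y := w1)) ?Kx ?eqxx ?orbT.
    - by move=> _ _; rewrite (single_inj (x := x) (y := w0)) ?Kx ?eqxx ?orbT.
    - by case: s Kx => Kx H0 H1; [have := H1 isT|have := H0 isT] => E; move: Kx; rewrite E ?Kz0 ?Kz1.
    - by case: s Kx => Kx H0 H1; [have := H1 isT|have := H0 isT] => E; move: Kx; rewrite E ?Kz0 ?Kz1.
  by rewrite size_p /=; lia.
have [i q def_p] := rot_to hub_p.
have size_q : size q = t.*2.+1 by apply: succn_inj; rewrite -size_p -(size_rot i p) def_p.
have uniq_hq : uniq (hub :: q) by rewrite -def_p rot_uniq.
have cyc_hq : cycle e (hub :: q) by rewrite -def_p rot_cycle.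
have size_hq : size (hub :: q) = t.*2.+2 by rewrite /= size_q.
case: q => [|y q] // in def_p size_q uniq_hq cyc_hq size_hq *.
have /andP[hubNq uniq_q] := uniq_hq.
have all_q : all nonhub (y :: q).
  by apply/allP => x xq; rewrite nonhubE; apply: contraNneq hubNq => <-.
move: (cyc_hq); rewrite /= rcons_path => /and3P[e_hy path_q e_lh].
have [s Ky] : exists s, kappa y = Outer s.
  by move: e_hy; rewrite /e /necklace_rel /necklace_adj Khub exists_bool; case: (kappa y) => // s; exists s.
have [s' Kl] : exists s', kappa (last y q) = Outer s'.
  by move: e_lh; rewrite /e /necklace_rel /necklace_adj Khub exists_bool; case: (kappa _) => [|[]|[]|[]|s1] //; exists s1.
have [eq_s|neq_s] := eqVneq s s'.
  have : cycle (e2 s) (y :: q).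
    rewrite /= rcons_path; apply/andP; split.
      apply: (sub_in_path (P := nonhub)) path_q => //.
      by move=> u w uN wN euw; apply/and3P; split; rewrite ?euw.
    by rewrite /e2 /nonhub Kl Ky /= eq_s eqxx orbT.
  case/(e2_cycle s (y :: q) uniq_q) => [sub_q|].
    have sub_hq : {subset hub :: y :: q <= block s}.
      by move=> x; rewrite inE => /predU1P[->|/sub_q//]; rewrite !inE Khub.
    by have := block_no_cycle size_hq uniq_hq sub_hq; rewrite cyc_hq.
  by move/(_ y (mem_head _ _)); rewrite !inE Ky /= eqxx => /(_ isT) E; move: Ky; rewrite E Kport.
have : cycle (fun x y => side (kappa x) != side (kappa y)) (y :: q).
  rewrite /= rcons_path; apply/andP; split.
    apply: (sub_in_path (P := nonhub)) path_q => //.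
    by move=> u w uN wN; apply: necklace_adj_side.
  by rewrite Kl Ky /=; case: (s) (s') neq_s => [] [].
by move/cycle_bipartite/(congr1 odd); rewrite size_q /= !odd_double.
Qed.

Lemma block_edge s a b :
  in_A s (kappa a) -> in_B s (kappa b) -> e a b.
Proof.
by rewrite /necklace_rel /necklace_adj => Aa Bb; apply/or3P/Or33/existsP; exists s; rewrite Aa Bb.
Qed.

Lemma block_disjoint s : [disjoint [set x | in_A s (kappa x)] & [set x | in_B s (kappa x)]].
Proof.
rewrite -setI_eq0; apply/eqP/setP=> x; rewrite !inE.
by case: (kappa x) => [|?|?|?|?] //=; rewrite andbF.
Qed.

Lemma block_linked_odd s l x y :
  in_A s (kappa x) -> in_B s (kappa y) -> l < t -> linked e (block s) l.*2.+1 x y.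
Proof.
move=> Ax By lt; apply: linked_bip; rewrite ?inE ?card_A ?block_disjoint //.
- exact: necklace_rel_sym.
- by move=> a b; rewrite !inE; apply: block_edge.
- exact: leq_trans lt (card_B s).
Qed.

Lemma block_linked_even s l x y :
  in_A s (kappa x) -> in_A s (kappa y) -> x <> y -> 0 < l < t ->
  linked e (block s) l.*2 x y.
Proof.
move=> Ax Ay /eqP nxy /andP[l0 lt].
apply: linked_bip_even; rewrite ?inE ?card_A ?block_disjoint //.
- exact: necklace_rel_sym.
- by move=> a b; rewrite !inE; apply: block_edge.
- exact: leq_trans (ltnW lt) (card_B s).
Qed.

Lemma outer_ex s x : exists2 b, kappa b = Outer s & b <> x.
Proof.
have /card_gt0P[b] : 0 < #|[set b | in_B s (kappa b)] :\ x|.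
  by have := card_B s; rewrite (cardsD1 x); lia.
rewrite !inE => /andP[/eqP nbx Kb]; exists b => //.
by case: (kappa b) Kb => //= s' /eqP->.
Qed.

Lemma kappa_neq x y : kappa x <> kappa y -> x != y.
Proof. by move=> nK; apply: contra_notN nK => /eqP->. Qed.

(* Each case below takes a path inside one block and prolongs it vertex by vertex
   at its start (pre) or at its end (post); adjacency and distinctness follow from
   the kinds of the vertices, and whole compares the final length with 2t + 1. *)
Ltac kinds := repeat match goal with K : kappa _ = _ |- _ => progress rewrite K end.
Ltac edge := rewrite /necklace_rel; kinds; by rewrite /necklace_adj exists_bool /= ?eqxx.
Ltac apart := match goal with
  | H : ?x <> ?y |- is_true (?x != ?y) => by apply/eqP
  | H : ?y <> ?x |- is_true (?x != ?y) => by rewrite eq_sym; apply/eqP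
  | Kx : kappa ?x = _, Ky : kappa ?y = _ |- is_true (?x != ?y) =>
      by apply: kappa_neq; rewrite Kx Ky
  | |- _ => by []
  end.
Ltac sep := rewrite !inE; kinds; rewrite /= ?negb_or; repeat (apply/andP; split); apart.
Ltac pre a L := apply (linked_cons (x := a)) in L; [|edge|sep].
Ltac post a L := apply (linked_rcons necklace_rel_sym (z := a)) in L; [|edge|sep].
Ltac whole L := apply: linked_sub (subsetT _) _;
  match type of L with linked _ _ ?l _ _ => rewrite (_ : t.*2.+1 = l); [exact: L|lia] end.

(** Crossing directly to the far port and on to y is 2 edges too short, hence the
    detour through the twin w of the far side and the other vertex x' of the gate
    of x. *)
Lemma gate_to_far_A s x y :
  kappa x = Port s \/ kappa x = Twin s -> in_A (~~ s) (kappa y) -> kappa y <> Port (~~ s) ->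
  linked e setT t.*2.+1 x y.
Proof.
move=> Kx Ay nKy.
have [d Kd] := single_ex (k := Port (~~ s)) isT.
have [w Kw] := single_ex (k := Twin (~~ s)) isT.
have ndy : d <> y by move=> E; rewrite -E in nKy.
have L : linked e (block (~~ s)) t.-1.*2 d y.
  by apply: block_linked_even => //; [rewrite Kd /= eqxx|lia].
have [x' Kx'] : exists x', kappa x' = Port s /\ kappa x = Twin s \/
                           kappa x' = Twin s /\ kappa x = Port s.
  have [u Ku] := single_ex (k := Port s) isT.
  have [v Kv] := single_ex (k := Twin s) isT.
  by case: Kx; [exists v; right|exists u; left].
case: s {Kx Ay nKy} Kx' Kd Kw L => -[] [Kx' Kx] Kd Kw L;
  pre x' L; pre w L; pre x L; whole L.
Qed.

(** From x around the necklace: far port, far block, hub, and two more edges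
    to y. *)
Lemma gate_to_near_A s x y :
  kappa x = Port s \/ kappa x = Twin s -> in_A s (kappa y) -> kappa y <> Hub -> x <> y ->
  linked e setT t.*2.+1 x y.
Proof.
move=> Kx Ay nKy nxy.
have [h Kh] := single_ex (k := Hub) isT.
have [d Kd] := single_ex (k := Port (~~ s)) isT.
have [b Kb _] := outer_ex s x.
have L : linked e (block (~~ s)) t.-1.*2 d h.
  apply: block_linked_even; rewrite ?Kd ?Kh /= ?eqxx //; last lia.
  by move=> E; move: Kd; rewrite E Kh.
have [Ky|Ky] : kappa y = Port s \/ kappa y = Inner s.
  by case: (kappa y) Ay nKy => //= s' /eqP->; auto.
- by case: s {Ay nKy} Kx Kd Kb Ky L => -[] Kx Kd Kb Ky L;
  post b L; post y L; pre x L; whole L.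
- by case: s {Ay nKy} Kx Kd Kb Ky L => -[] Kx Kd Kb Ky L;
  post b L; post y L; pre x L; whole L.
Qed.

Lemma hub_to_inner s x y :
  kappa x = Hub -> kappa y = Inner s -> linked e setT t.*2.+1 x y.
Proof.
move=> Kx Ky.
have [c Kc] := single_ex (k := Port s) isT.
have [d Kd] := single_ex (k := Port (~~ s)) isT.
have [b Kb _] := outer_ex s x.
have L : linked e (block (~~ s)) t.-1.*2 x d.
  apply: block_linked_even; rewrite ?Kd ?Kx /= ?eqxx //; last lia.
  by move=> E; move: Kd; rewrite -E Kx.
by case: s Ky Kc Kd Kb L => Ky Kc Kd Kb L; post c L; post b L; post y L; whole L.
Qed.

(** Both x and y spend two edges in their own block, so the stretch in the far
    block has only 2t - 4 edges.  This is positive because two inner vertices on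
    one side force t >= 4. *)
Lemma inner_to_inner s x y :
  kappa x = Inner s -> kappa y = Inner s -> x <> y -> linked e setT t.*2.+1 x y.
Proof.
move=> Kx Ky nxy.
have [h Kh] := single_ex (k := Hub) isT.
have [c Kc] := single_ex (k := Port s) isT.
have [d Kd] := single_ex (k := Port (~~ s)) isT.
have [b Kb _] := outer_ex s x; have [b' Kb' nbb] := outer_ex s b.
have t_ge4 : 4 <= t.
  rewrite -(card_A s); have uq : uniq [:: h; c; x; y].
    by rewrite /= !inE !negb_or; repeat (apply/andP; split); apart.
  rewrite -[4]/(size [:: h; c; x; y]) -(card_uniqP uq); apply/subset_leq_card/subsetP => u.
  by rewrite !inE => /or4P[]/eqP->; rewrite ?Kh ?Kc ?Kx ?Ky /= ?eqxx.
have L : linked e (block (~~ s)) t.-2.*2 d h.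
  apply: block_linked_even; rewrite ?Kd ?Kh /= ?eqxx //; last lia.
  by move=> E; move: Kd; rewrite E Kh.
by case: s Kx Ky Kc Kd Kb Kb' L => Kx Ky Kc Kd Kb Kb' L;
  pre c L; pre b L; pre x L; post b' L; post y L; whole L.
Qed.

Lemma outer_to_outer_same s x y :
  kappa x = Outer s -> kappa y = Outer s -> x <> y -> linked e setT t.*2.+1 x y.
Proof.
move=> Kx Ky nxy.
have [h Kh] := single_ex (k := Hub) isT.
have [c Kc] := single_ex (k := Port s) isT.
have [d Kd] := single_ex (k := Port (~~ s)) isT.
have L : linked e (block (~~ s)) t.-1.*2 d h.
  apply: block_linked_even; rewrite ?Kd ?Kh /= ?eqxx //; last lia.
  by move=> E; move: Kd; rewrite E Kh.
by case: s Kx Ky Kc Kd L => Kx Ky Kc Kd L; pre c L; pre x L; post y L; whole L.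
Qed.

Lemma A_to_far_outer s x y :
  in_A s (kappa x) -> kappa x <> Hub -> kappa y = Outer (~~ s) ->
  linked e setT t.*2.+1 x y.
Proof.
move=> Ax nKx Ky.
have [h Kh] := single_ex (k := Hub) isT.
have [b Kb _] := outer_ex s x.
have L : linked e (block (~~ s)) t.-1.*2.+1 h y.
  by apply: block_linked_odd; rewrite ?Kh ?Ky /= ?eqxx //; lia.
have [Kx|Kx] : kappa x = Port s \/ kappa x = Inner s.
  by case: (kappa x) Ax nKx => //= s' /eqP->; auto.
- by case: s {Ax nKx} Kx Ky Kb L => Kx Ky Kb L; pre b L; pre x L; whole L.
- by case: s {Ax nKx} Kx Ky Kb L => Kx Ky Kb L; pre b L; pre x L; whole L.
Qed.

Lemma outer_to_outer_far s x y :
  kappa x = Outer s -> kappa y = Outer (~~ s) -> linked e setT t.*2.+1 x y.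
Proof.
move=> Kx Ky.
have [c Kc] := single_ex (k := Port s) isT.
have [d Kd] := single_ex (k := Port (~~ s)) isT.
have L : linked e (block (~~ s)) t.-1.*2.+1 d y.
  by apply: block_linked_odd; rewrite ?Kd ?Ky /= ?eqxx //; lia.
by case: s Kx Ky Kc Kd L => Kx Ky Kc Kd L; pre c L; pre x L; whole L.
Qed.

Lemma twin_to_near_outer s x y :
  kappa x = Twin s -> kappa y = Outer s -> linked e setT t.*2.+1 x y.
Proof.
move=> Kx Ky.
have [c Kc] := single_ex (k := Port s) isT.
have [w Kw] := single_ex (k := Twin (~~ s)) isT.
have L : linked e (block s) t.-1.*2.+1 c y.
  by apply: block_linked_odd; rewrite ?Kc ?Ky /= ?eqxx //; lia.
by case: s Kx Ky Kc Kw L => Kx Ky Kc Kw L; pre w L; pre x L; whole L.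
Qed.

(** Crossing to the far port and then the far block would give an even length,
    so the path uses both twins, the near port and the near block to reach the
    hub, and y from there. *)
Lemma twin_to_far_outer s x y :
  kappa x = Twin s -> kappa y = Outer (~~ s) -> linked e setT t.*2.+1 x y.
Proof.
move=> Kx Ky.
have [h Kh] := single_ex (k := Hub) isT.
have [c Kc] := single_ex (k := Port s) isT.
have [w Kw] := single_ex (k := Twin (~~ s)) isT.
have [b Kb _] := outer_ex s x.
have L : linked e (block (~~ s)) t.-2.*2.+1 h y.
  by apply: block_linked_odd; rewrite ?Kh ?Ky /= ?eqxx //; lia.
by case: s Kx Ky Kc Kw Kb L => Kx Ky Kc Kw Kb L;
  pre b L; pre c L; pre w L; pre x L; whole L.
Qed.

Lemma inner_to_far_inner s x y :
  kappa x = Inner s -> kappa y = Inner (~~ s) -> linked e setT t.*2.+1 x y.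
Proof.
move=> Kx Ky.
have [c Kc] := single_ex (k := Port s) isT.
have [d Kd] := single_ex (k := Port (~~ s)) isT.
have [b Kb _] := outer_ex s x.
have L : linked e (block (~~ s)) t.-1.*2 d y.
  apply: block_linked_even; rewrite ?Kd ?Ky /= ?eqxx //; last lia.
  by move=> E; move: Kd; rewrite E Ky.
by case: s Kx Ky Kc Kd Kb L => Kx Ky Kc Kd Kb L; pre c L; pre b L; pre x L; whole L.
Qed.

Ltac link s u v := let by_kind := (kinds; by auto) in first
  [ solve [apply: (@gate_to_far_A s u v); by_kind]
  | solve [apply: (@gate_to_near_A s u v); by_kind]
  | solve [apply: (@hub_to_inner s u v); by_kind]
  | solve [apply: (@inner_to_inner s u v); by_kind]
  | solve [apply: (@inner_to_far_inner s u v); by_kind]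
  | solve [apply: (@outer_to_outer_same s u v); by_kind]
  | solve [apply: (@outer_to_outer_far s u v); by_kind]
  | solve [apply: (@A_to_far_outer s u v); by_kind]
  | solve [apply: (@twin_to_near_outer s u v); by_kind]
  | solve [apply: (@twin_to_far_outer s u v); by_kind] ].

(** Up to exchanging x and y, and the two sides, each pair of kinds is adjacent
    or falls under one of the cases above. *)
Lemma necklace_linked x y : x != y -> ~~ e x y -> linked e setT t.*2.+1 x y.
Proof.
move=> /eqP nxy; have nyx : y <> x by move=> E; apply: nxy.
rewrite /necklace_rel.
case Kx: (kappa x) => [|[]|[]|[]|[]]; case Ky: (kappa y) => [|[]|[]|[]|[]];
  rewrite /necklace_adj exists_bool //= => _;
  first [ by case: nxy; apply: single_inj; rewrite Kx
        | link true x y | link false x y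
        | apply: (linked_sym necklace_rel_sym); first [link true y x | link false y x] ].
Qed.
End Necklace.

(** * Realization on n vertices *)

Lemma card_interval n a b : b <= n -> #|[set i : 'I_n | a <= i < b]| = b - a.
Proof.
move=> le_bn; rewrite cardsE -sum1_card -(muln1 (b - a)) -sum_nat_const_nat.
rewrite (big_nat_widenl _ 0) // (big_nat_widen _ _ _ _ _ le_bn) big_mkord.
by apply: eq_bigl => i; rewrite -topredE.
Qed.

Lemma sat_triangle_odd_cycle n t : 1 < t -> t.*2.+2 <= n ->
  sat n (complete_graph 3) (cycle_graph t.*2.+1) = Some 0.
Proof.
move=> t1 le_n; pose chi (x : 'I_n) := x <= t.
have card_chi b : t < #|[set x | chi x == b]|.
  have -> : [set x | chi x == b] =
      [set x : 'I_n | (if b then 0 else t.+1) <= x < (if b then t.+1 else n)].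
    by apply/setP => x; rewrite !inE /chi; case: b; have := ltn_ord x; lia.
  by rewrite card_interval; case: b; lia.
have bip x y z : chi x != chi y -> chi y != chi z -> ~~ (chi x != chi z).
  by case: (chi x) (chi y) (chi z) => [] [] [].
apply: (@sat_triangle_cycle_eq0 _ _ (fun x y => chi x != chi y)) => //=.
- by lia.
- by move=> x y; rewrite eq_sym.
- move=> p size_p _; apply/negP => /cycle_bipartite/(congr1 odd).
  by rewrite size_p /= !odd_double.
move=> x y nxy; rewrite negbK => /eqP chi_xy.
apply: (linked_sub (subsetT ([set u | chi u == chi x] :|: [set u | chi u == ~~ chi x]))).
apply: linked_bip_even => //; rewrite ?inE ?chi_xy //.
- by move=> u v; rewrite eq_sym.
- rewrite -setI_eq0; apply/eqP/setP => u; rewrite !inE.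
  by case: (chi u) (chi y) => [] [].
- by move=> u v; rewrite !inE => /eqP-> /eqP->; case: (chi y).
- by lia.
exact: ltnW.
Qed.

(** With this numbering A false = [0, t) and A true = [t - 1, 2t - 1) are intervals
    that overlap in the hub t - 1, and the ports are their other ends.  All
    surplus vertices are put in B true. *)
Definition necklace_label (t i : nat) : kind :=
  if i == 0 then Port false else
  if i < t.-1 then Inner false else
  if i == t.-1 then Hub else
  if i < t.*2.-2 then Inner true else
  if i == t.*2.-2 then Port true else
  if i == t.*2.-1 then Twin false else
  if i == t.*2 then Twin true else
  Outer (3 * t < i).

Lemma sat_triangle_even_cycle n t : 1 < t -> 4 * t + 1 <= n ->
  sat n (complete_graph 3) (cycle_graph t.*2.+2) = Some 0.
Proof.
move=> t1 le_n; pose kappa (x : 'I_n) := necklace_label t x.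
have single_inj x y : single (kappa x) -> kappa x = kappa y -> x = y.
  rewrite /kappa /necklace_label => sx exy; apply: val_inj; move: sx exy => /=.
  by do 7?[case: ifP => ?]; do 7?[case: ifP => ?] => //=; lia.
have label_ex k (i : nat) : i < n -> necklace_label t i = k -> exists x, kappa x = k.
  by move=> lt_in; exists (Ordinal lt_in).
have single_ex k : single k -> exists x, kappa x = k.
  case: k => [|[]|[]|?|?] // _.
  - by apply: (@label_ex _ t.-1); rewrite /necklace_label; do 8?[case: ifP => ?] => //; lia.
  - by apply: (@label_ex _ t.*2.-2); rewrite /necklace_label; do 8?[case: ifP => ?] => //; lia.
  - by apply: (@label_ex _ 0); rewrite /necklace_label; do 8?[case: ifP => ?] => //; lia.
  - by apply: (@label_ex _ t.*2); rewrite /necklace_label; do 8?[case: ifP => ?] => //; lia.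
  - by apply: (@label_ex _ t.*2.-1); rewrite /necklace_label; do 8?[case: ifP => ?] => //; lia.
have card_A s : #|[set x | in_A s (kappa x)]| = t.
  have -> : [set x | in_A s (kappa x)] =
      [set x : 'I_n | (if s then t.-1 else 0) <= x < (if s then t.*2.-1 else t)].
    apply/setP => x; rewrite !inE /kappa /necklace_label.
    by case: s; do 8?[case: ifP => ?] => /=; lia.
  by rewrite card_interval; case: s; lia.
have card_B s : t <= #|[set x | in_B s (kappa x)]|.
  have -> : [set x | in_B s (kappa x)] =
      [set x : 'I_n | (if s then (3 * t).+1 else t.*2.+1) <= x < (if s then n else (3 * t).+1)].
    apply/setP => x; rewrite !inE /kappa /necklace_label; have := ltn_ord x.
    by case: s; do 8?[case: ifP => ?] => /=; lia.
  by rewrite card_interval; case: s; lia.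
apply: (@sat_triangle_cycle_eq0 _ _ (necklace_rel kappa)) => //.
- by lia.
- exact: necklace_rel_sym.
- by move=> x y z; apply: necklace_adj_triangle.
- by move=> p; apply: (necklace_no_cycle t1 single_inj single_ex card_A).
by move=> x y; apply: (necklace_linked t1 single_inj single_ex card_A card_B).
Qed.

Theorem theorem1p9 (k n : nat) (hk : 5 <= k) (hn : 2 * k + 2 <= n) :
  sat n (complete_graph 3) (cycle_graph k) = Some 0.
Proof.
have := odd_double_half k; case: (odd k) => /= kE; rewrite -kE.
  by apply: sat_triangle_odd_cycle; lia.
have -> : 0 + k./2.*2 = k./2.-1.*2.+2 by lia.
by apply: sat_triangle_even_cycle; lia.
Qed.
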